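(* For every integer $r\geq 1$, the following identity of formal power series holds: $$ \Psi_r(x)=\sum_{\rho\in K_{2r+1}}\left(x^{s(\rho)}\sum_{\substack{r_1+\dots+r_{f(\rho)}=r-c(\rho)\\ r_j\geq 0\ (1\leq j\leq f(\rho))}}\;\prod_{j=1}^{f(\rho)}\Psi_{r_j}(x)\right). $$ Here the inner sum is empty, hence equal to $0$, when $r-c(\rho)<0$.
   Context: Patterns. For $\pi\in S_n$, written $\pi(1)\pi(2)\dots\pi(n)$, and $\tau\in S_m$, an occurrence of $\tau$ in $\pi$ is a sequence of indices $1\leq i_1<\dots<i_m\leq n$ such that $(\pi(i_1),\dots,\pi(i_m))$ is order-isomorphic to $\tau$. In particular, an occurrence of $132$ is a triple of positions $i<j<k$ with $\pi(i)<\pi(k)<\pi(j)$. Counting functions. $\psi_r(n)$ is the number of permutations in $S_n$ containing exactly $r$ occurrences of $132$. Here $S_0$ consists of the empty permutation, so $\psi_0(0)=1$. The generating function is $\Psi_r(x)=\sum_{n\geq 0}\psi_r(n)x^n$. The graph $G_\pi$. For $\pi\in S_n$, $G_\pi$ is the bipartite graph with vertex classes $V_1$ and $V_3$. The class $V_1$ is the set of entries of $\pi$, and $V_3$ is the set of occurrences of $132$ in $\pi$. An entry is joined to an occurrence exactly when it is one of the three entries of that occurrence. $G_\pi^n$ denotes the connected component of $G_\pi$ containing the entry $n$. Kernels. Let $\pi(i_1),\dots,\pi(i_s)$, with $i_1<\dots<i_s$, be the entries of $\pi$ lying in $G_\pi^n$. - This subsequence is the kernel of $\pi$. - The permutation $\sigma_\pi\in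 S_s$ order-isomorphic to it is the kernel shape. - $s$ is the size of the kernel. - The number of occurrences of $132$ in $\sigma_\pi$ is the capacity. A permutation $\rho$ is a kernel permutation if $\rho=\sigma_\pi$ for some permutation $\pi$; equivalently, $\sigma_\rho=\rho$. For a kernel permutation $\rho$, write $s(\rho)$ for its length and $c(\rho)$ for its number of occurrences of $132$. $K_t$ denotes the set of all kernel shapes $\sigma_\pi$ for $\pi\in S_t$. Cells. Let $\rho\in S_s$ be a kernel permutation. For $1\leq m\leq s$ and $1\leq l\leq s+1$, the cell $(m,l)$ consists of the positions strictly between the $(l-1)$-st and $l$-th kernel positions and the values strictly between the $(m-1)$-st and $m$-th smallest kernel values. - The cell $(m,l)$ is infeasible if, in the sequence $(\rho(1),\dots,\rho(l-1),\,m-\tfrac12,\,\rho(l),\dots,\rho(s))$, the inserted entry $m-\tfrac12$ belongs to some occurrence of the pattern $132$. - Otherwise the cell is feasible. - $f(\rho)$ is the number of feasible cells of $\rho$. *)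

(* Defs.v *)
From HB Require Import structures.
From mathcomp Require Import all_boot all_order all_algebra all_fingroup.
From mathcomp Require Import boolp.
Set Implicit Arguments.
Unset Strict Implicit.
Unset Printing Implicit Defensive.
Import Order.TTheory GRing.Theory Num.Theory.
Local Open Scope ring_scope.

(* All indices are 0-based: p : 'S_n is a permutation of
   {0, ..., n-1}, and its largest entry is n-1. *)

Record fps (R : comNzRingType) := FPS { fcoef : nat -> R }.

Section FpsRing.
Variable R : comNzRingType.
Implicit Types f g h : fps R.

HB.instance Definition _ := gen_eqMixin (fps R).
HB.instance Definition _ := gen_choiceMixin (fps R).

Definition fps_zero : fps R := FPS (fun=> 0).
Definition fps_opp f : fps R := FPS (fun n => - fcoef f n).
Definition fps_add f g : fps R := FPS (fun n => fcoef f n + fcoef g n).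
Definition fps_one : fps R := FPS (fun n => (n == 0%N)%:R).
Definition fps_mul f g : fps R :=
  FPS (fun n => \sum_(i < n.+1) fcoef f i * fcoef g (n - i)%N).

Lemma fpsP f g : (forall n, fcoef f n = fcoef g n) -> f = g.
Proof. by case: f g => [f] [g] /= fg; congr FPS; apply: funext. Qed.

Let trunc n f : {poly R} := \poly_(i < n) fcoef f i.

Let fcoef_mul_trunc n k f g : (k < n)%N ->
  fcoef (fps_mul f g) k = (trunc n f * trunc n g)`_k.
Proof.
move=> lt_kn; rewrite coefM /=; apply: eq_bigr => i _.
have le_ik : (i <= k)%N by rewrite -ltnS.
by rewrite !coef_poly (leq_ltn_trans le_ik lt_kn)
           (leq_ltn_trans (leq_subr _ _) lt_kn).
Qed.

Fact fps_addA : associative fps_add.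
Proof. by move=> f g h; apply: fpsP => n /=; rewrite addrA. Qed.
Fact fps_addC : commutative fps_add.
Proof. by move=> f g; apply: fpsP => n /=; rewrite addrC. Qed.
Fact fps_add0 : left_id fps_zero fps_add.
Proof. by move=> f; apply: fpsP => n /=; rewrite add0r. Qed.
Fact fps_addN : left_inverse fps_zero fps_opp fps_add.
Proof. by move=> f; apply: fpsP => n /=; rewrite addNr. Qed.

Fact fps_mulC : commutative fps_mul.
Proof.
by move=> f g; apply: fpsP => n; rewrite !(fcoef_mul_trunc _ _ (ltnSn n)) mulrC.
Qed.

Fact fps_mulA : associative fps_mul.
Proof.
have mulE f g h n : fcoef (fps_mul f (fps_mul g h)) n =
    (trunc n.+1 f * (trunc n.+1 g * trunc n.+1 h))`_n.
  rewrite coefM /=; apply: eq_bigr => i _.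
  rewrite -(@fcoef_mul_trunc n.+1 (n - i)) ?ltnS ?leq_subr //=.
  by rewrite coef_poly ltn_ord.
move=> f g h; apply: fpsP => n.
by rewrite (fps_mulC (fps_mul f g)) !mulE mulrA mulrC.
Qed.

Fact fps_mul1 : left_id fps_one fps_mul.
Proof.
move=> f; apply: fpsP => n /=; rewrite big_ord_recl /= subn0 mul1r.
by rewrite big1 ?addr0 // => i _; rewrite mul0r.
Qed.

Fact fps_mulDl : left_distributive fps_mul fps_add.
Proof.
move=> f g h; apply: fpsP => n /=; rewrite -big_split /=.
by apply: eq_bigr => i _; rewrite mulrDl.
Qed.

Fact fps_one_neq0 : fps_one != fps_zero.
Proof.
by apply/eqP => /(congr1 (fun f => fcoef f 0)) /= /eqP; rewrite oner_eq0.
Qed.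

HB.instance Definition _ := GRing.isZmodule.Build (fps R)
  fps_addA fps_addC fps_add0 fps_addN.
HB.instance Definition _ := GRing.Zmodule_isComNzRing.Build (fps R)
  fps_mulA fps_mulC fps_mul1 fps_mulDl fps_one_neq0.

Definition fpsX : fps R := FPS (fun n => (n == 1%N)%:R).

End FpsRing.

Section Occurrences.
Local Open Scope order_scope.

Definition occ132 d (T : porderType d) n (w : 'I_n -> T) :
    {set 'I_n * 'I_n * 'I_n} :=
  [set t : 'I_n * 'I_n * 'I_n | [&& (t.1.1 < t.1.2)%N, (t.1.2 < t.2)%N,
               w t.1.1 < w t.2 & w t.2 < w t.1.2]].

End Occurrences.

Definition in_occ n (i : 'I_n) (t : 'I_n * 'I_n * 'I_n) : bool :=
  [|| i == t.1.1, i == t.1.2 | i == t.2].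

Definition perm_occ n (p : 'S_n) : {set 'I_n * 'I_n * 'I_n} :=
  occ132 (fun i => p i).

Definition psi (r n : nat) : nat := #|[set p : 'S_n | #|perm_occ p| == r]|.

Definition Psi (r : nat) : fps int := FPS (fun n => (psi r n)%:R).

(* The entry p i is represented by its position i. *)
Definition occ_graph n (p : 'S_n) : rel ('I_n + {t | t \in perm_occ p}) :=
  fun u v => match u, v with
    | inl i, inr t | inr t, inl i => in_occ i (val t)
    | _, _ => false
    end.

Definition kernel_pos n (p : 'S_n) : {set 'I_n} :=
  [set i : 'I_n | [exists j : 'I_n,
     ((p j).+1 == n) && connect (@occ_graph n p) (inl j) (inl i)]].

(* enum lists the elements of a set of ordinals in increasing order. *)
Definition kernel n (p : 'S_n) : seq nat :=
  [seq nat_of_ord (p i) | i <- enum (kernel_pos p)].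

Definition word n (p : 'S_n) : seq nat :=
  [seq nat_of_ord (p i) | i <- enum 'I_n].

Definition order_iso (u v : seq nat) : bool :=
  (size u == size v) &&
  [forall i : 'I_(size u), forall j : 'I_(size u),
     (nth 0 u i < nth 0 u j)%N == (nth 0 v i < nth 0 v j)%N].

Definition is_kernel_shape n (p : 'S_n) s (rho : 'S_s) : bool :=
  order_iso (word rho) (kernel p).

(* Kernel shapes of permutations of length t have varying length s <= t, hence
   the dependent pairs. *)
Definition kernel_shapes (t : nat) : {set {s : 'I_t.+1 & 'S_s}} :=
  [set rho | [exists p : 'S_t, is_kernel_shape p (tagged rho)]].

Definition capacity s (rho : 'S_s) : nat := #|perm_occ rho|.

(* The sequence rho with m - 1/2 inserted at position l.  Shifting m, l and the
   values of rho from 1-based to 0-based leaves the formula unchanged. *)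
Definition insert_half s (rho : 'S_s) (m : 'I_s) (l : 'I_s.+1) :
    'I_s.+1 -> rat :=
  fun i => if unlift l i is Some j then (rho j)%:R else m%:R - 2^-1.

Definition infeasible s (rho : 'S_s) (c : 'I_s * 'I_s.+1) : bool :=
  [exists t in occ132 (insert_half rho c.1 c.2), in_occ c.2 t].

Definition feasible_count s (rho : 'S_s) : nat :=
  #|[set c : 'I_s * 'I_s.+1 | ~~ infeasible rho c]|.

(* The tuples (r_1, ..., r_f) of natural numbers with r_1 + ... + r_f = r - c;
   the condition is written additively so that there are none when r < c.  Each
   r_j is at most r, whence the codomain 'I_r.+1. *)
Definition weak_compositions (f r c : nat) : {set {ffun 'I_f -> 'I_r.+1}} :=
  [set g : {ffun 'I_f -> 'I_r.+1} | (\sum_j g j + c == r)%N].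

(* Main.v *)
Require Import Defs.
From mathcomp Require Import all_boot all_order all_algebra all_fingroup.
From mathcomp Require Import zify lra.
Import Order.TTheory GRing.Theory Num.Theory.
Set Implicit Arguments.
Unset Strict Implicit.
Unset Printing Implicit Defensive.

(* An occurrence of 132 meeting the kernel lies inside it, so every other entry
   of a permutation lies in a feasible cell of its kernel shape.  Connectedness
   of the kernel forces every kernel entry to the left of a feasible cell to be
   larger than the entries of that cell; hence, read from left to right, the
   contents of distinct feasible cells are decreasing, and every occurrence
   outside the kernel lies inside a single cell.  A permutation with kernel shape
   rho is therefore the same as a family of arbitrary permutations indexed by the
   feasible cells of rho, and occurrences add up.  A connected graph with r
   occurrence vertices of degree 3 has at most 2r+1 entries, so K_{2r+1} contains
   all the shapes that matter. *)

(** * Standardization *)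

(** By trichotomy a single implication is enough. This halves the case analysis when position and
    value keys are compared later. *)
Lemma mono_of_homo_ltn (T : Type) (f g : T -> nat) :
    injective f -> (forall x y, f x < f y -> g x < g y) ->
  forall x y, (g x < g y) = (f x < f y).
Proof.
move=> f_inj fg x y; case: (ltngtP (f x) (f y)) => [/fg // | /fg | /f_inj ->].
  by move=> lt_gyx; rewrite ltnNge ltnW.
by rewrite ltnn.
Qed.

Lemma inj_of_mono_ltn (T : Type) (f g : T -> nat) :
    injective f -> (forall x y, (g x < g y) = (f x < f y)) -> injective g.
Proof.
move=> f_inj fg x y eq_g; apply: f_inj.
by case: (ltngtP (f x) (f y)) => //; rewrite -fg eq_g ltnn.
Qed.

(** The rank of [x] is the number of points with a smaller value of [f]. *)
Lemma rank_exists (P : finType) n (f : P -> nat) :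
    injective f -> #|P| = n ->
  exists e : P -> 'I_n, forall x y, (e x < e y) = (f x < f y).
Proof.
move=> f_inj <-.
have rank_lt x : #|[set y | f y < f x]| < #|P|.
  rewrite -cardsT; apply: proper_card; rewrite properT.
  by apply/eqP => /setP/(_ x); rewrite !inE ltnn.
exists (fun x => Ordinal (rank_lt x)); apply: mono_of_homo_ltn => // x y lt_xy.
apply: proper_card; apply/properP; split.
  by apply/subsetP => z; rewrite !inE => /ltn_trans; apply.
by exists x; rewrite !inE ?ltnn.
Qed.

Lemma card_ltn_ord n m : m <= n -> #|[set i : 'I_n | i < m]| = m.
Proof.
move=> le_mn; rewrite cardsE -sum1_card;
by rewrite [LHS](big_ord_narrow le_mn) sum1_card card_ord.
Qed.

Lemma rankE (P : finType) n (e : P -> 'I_n) x :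
  injective e -> #|P| = n -> e x = #|[set y | e y < e x]| :> nat.
Proof.
move=> e_inj cardP.
have [e' eK e'K] : bijective e by apply: inj_card_bij; rewrite ?card_ord ?cardP.
rewrite -[LHS](card_ltn_ord (ltnW (ltn_ord (e x)))) -(card_imset _ e_inj).
apply: eq_card => i; rewrite inE; apply/idP/imsetP => [lt_i | [y]].
  by exists (e' i); rewrite ?inE e'K.
by rewrite inE => lt_y ->.
Qed.

(** By [rankE], both [e x] and [e' x] count the points below [x], and the order determines this
    count. *)
Lemma rank_unique (P : finType) n (e e' : P -> 'I_n) :
    injective e -> #|P| = n -> (forall x y, (e x < e y) = (e' x < e' y)) ->
  e =1 e'.
Proof.
move=> e_inj cardP ee' x; apply: val_inj => /=.
have e'_inj : injective e'.
  have vi : injective (fun x => e x : nat) by move=> y z /val_inj/e_inj.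
  move=> y z eq_yz; apply: (inj_of_mono_ltn vi (fun y z => esym (ee' y z))).
  by rewrite eq_yz.
rewrite (rankE _ e_inj cardP) (rankE _ e'_inj cardP).
by apply: eq_card => y; rewrite !inE ee'.
Qed.

Lemma std_exists k (f : 'I_k -> nat) : injective f ->
  exists q : 'S_k, forall u v, (q u < q v) = (f u < f v).
Proof.
move=> f_inj; have [e ef] := rank_exists f_inj (card_ord k).
have e_inj : injective e.
  by move=> u v eq_e; apply: (inj_of_mono_ltn f_inj ef); rewrite eq_e.
by exists (perm e_inj) => u v; rewrite !permE.
Qed.

Lemma std_unique k (q q' : 'S_k) :
  (forall u v, (q u < q v) = (q' u < q' v)) -> q = q'.
Proof.
by move=> qq'; apply/permP/(rank_unique (@perm_inj _ q) (card_ord k)).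
Qed.

Lemma order_isoE (u v : seq nat) k : size u = k -> size v = k ->
  order_iso u v = [forall i : 'I_k, forall j : 'I_k,
     (nth 0 u i < nth 0 u j) == (nth 0 v i < nth 0 v j)].
Proof. by move=> <- sz_v; rewrite /order_iso sz_v eqxx. Qed.

(** Working form of [order_iso]: [q] is the pattern of [p] on the positions [C], and the explicit
    [e] lets occurrences be moved between [q] and [p]. *)
Definition embeds n (p : 'S_n) (C : {set 'I_n}) k (q : 'S_k)
    (e : 'I_k -> 'I_n) : Prop :=
  [/\ forall u v, (e u < e v) = (u < v),
      forall u v, (p (e u) < p (e v)) = (q u < q v)
    & C = e @: setT].

Section Embeds.
Variables (n : nat) (p : 'S_n) (C : {set 'I_n}).

Lemma sorted_enum_set : sorted (fun i j : 'I_n => i < j) (enum C).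
Proof.
rewrite /enum_mem; apply: sorted_filter; first by move=> x y z; apply: ltn_trans.
rewrite -enumT -(@sorted_map _ _ val ltn) val_enum_ord; exact: iota_ltn_sorted.
Qed.

Lemma sorted_enum_ord k : sorted (fun i j : 'I_k => i < j) (enum 'I_k).
Proof.
rewrite -(@sorted_map _ _ val ltn) val_enum_ord; exact: iota_ltn_sorted.
Qed.

Lemma increasing_enum k (e : 'I_k -> 'I_n) :
    (forall u v, (e u < e v) = (u < v)) -> C = e @: setT ->
  enum C = [seq e u | u <- enum 'I_k].
Proof.
move=> e_mono defC; apply: irr_sorted_eq (sorted_enum_set) _ _.
- by move=> x y z; apply: ltn_trans.
- by move=> x; rewrite /= ltnn.
- rewrite sorted_map (eq_sorted (e' := fun u v : 'I_k => u < v)) //.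
  exact: sorted_enum_ord.
move=> i; rewrite mem_enum defC; apply/imsetP/mapP => -[u _ ->]; exists u => //.
by rewrite mem_enum.
Qed.

Lemma embeds_inj k (q : 'S_k) e : embeds p C q e -> injective e.
Proof.
case=> e_mono _ _ u v eq_e; apply: val_inj; apply: contra_eq (erefl (e v)).
by rewrite neq_ltn -!e_mono eq_e ltnn.
Qed.

Lemma embeds_exists : exists (q : 'S_#|C|) e, embeds p C q e.
Proof.
have pe_inj : injective (fun u : 'I_#|C| => p (enum_val u) : nat).
  by move=> u v /val_inj/perm_inj/enum_val_inj.
have [q qE] := std_exists pe_inj; exists q, (@enum_val _ (mem C)).
split => [| u v |].
- apply: mono_of_homo_ltn => [|u v lt_uv]; first exact: val_inj.
  rewrite (enum_val_nth (p (enum_val u))) (enum_val_nth (p (enum_val u)) v).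
  have lt_tr : transitive (fun i j : 'I_n => i < j).
    by move=> x y z; apply: ltn_trans.
  by apply: (sorted_ltn_nth lt_tr _ sorted_enum_set); rewrite // inE -cardE.
- by rewrite qE.
apply/setP => i; apply/idP/imsetP => [Ci | [u _ ->]]; last exact: enum_valP.
by exists (enum_rank_in Ci i); rewrite ?inE // enum_rankK_in.
Qed.

Lemma embeds_unique_emb k (q q' : 'S_k) e e' :
  embeds p C q e -> embeds p C q' e' -> e =1 e'.
Proof.
case=> e_mono _ defC [e'_mono _ defC'] u.
have := increasing_enum e'_mono defC'; rewrite (increasing_enum e_mono defC).
by move/eq_in_map; apply; rewrite mem_enum.
Qed.

Lemma embeds_card k (q : 'S_k) e : embeds p C q e -> k = #|C|.
Proof.
move=> emb; case: (emb) => _ _ ->.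
by rewrite card_imset ?cardsT ?card_ord //; apply: embeds_inj emb.
Qed.

(** Both lengths equal [#|C|], but only propositionally, hence the comparison of dependent pairs. *)
Lemma embeds_unique N (x y : {k : 'I_N & 'S_k}) e e' :
  embeds p C (tagged x) e -> embeds p C (tagged y) e' -> x = y.
Proof.
case: x y e e' => [k q] [k' q'] /= e e' emb emb'.
have eq_k : k = k'.
  by apply: val_inj; rewrite /= (embeds_card emb) (embeds_card emb').
subst k'; congr Tagged.
have ee' := embeds_unique_emb emb emb'.
apply: std_unique => u v; case: emb emb' => _ <- _ [_ <- _].
by rewrite !ee'.
Qed.

(** When [C] is [kernel_pos p], the boolean is [is_kernel_shape p q] by definition. *)
Lemma embedsP k (q : 'S_k) :
  reflect (exists e, embeds p C q e)
          (order_iso (word q) [seq nat_of_ord (p i) | i <- enum C]).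
Proof.
have isoE (q0 : 'S_k) (e : 'I_k -> 'I_n) :
    order_iso (word q0) [seq nat_of_ord (p (e u)) | u <- enum 'I_k]
    = [forall u : 'I_k, forall v : 'I_k, (q0 u < q0 v) == (p (e u) < p (e v))].
  rewrite (@order_isoE _ _ k); try by rewrite size_map size_enum_ord.
  have nthE (f : 'I_k -> nat) (u : 'I_k) : nth 0 [seq f x | x <- enum 'I_k] u = f u.
    by rewrite (nth_map u) ?size_enum_ord // nth_ord_enum.
  by apply: eq_forallb => u; apply: eq_forallb => v; rewrite !nthE.
apply: (iffP idP) => [iso | [d [e_mono pe defC]]].
  have eq_k : k = #|C|.
    by case/andP: iso => /eqP; rewrite /word size_map size_enum_ord size_map -cardE.
  move: embeds_exists; rewrite -eq_k => -[q0 [e [e_mono pe defC]]].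
  exists e; split => // u v; move: iso.
  rewrite (increasing_enum e_mono defC) -map_comp isoE.
  by move/forallP/(_ u)/forallP/(_ v)/eqP.
rewrite (increasing_enum e_mono defC) -map_comp isoE.
by apply/forallP => u; apply/forallP => v; rewrite pe.
Qed.

End Embeds.

(** * Kernels *)

Section Kernel.
Variables (n : nat) (p : 'S_n).

Lemma perm_occE a c b : ((a, c, b) \in perm_occ p) =
  [&& a < c, c < b, p a < p b & p b < p c].
Proof. by rewrite inE /= !ltEord. Qed.

(** These are the unions of connected components of the graph, seen on entries only. *)
Definition occ_closed (X : {set 'I_n}) : Prop :=
  forall a c b, (a, c, b) \in perm_occ p ->
    [|| a \in X, c \in X | b \in X] -> [&& a \in X, c \in X & b \in X].

Lemma kernel_max j : (p j).+1 = n -> j \in kernel_pos p.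
Proof.
by move=> max_j; rewrite inE; apply/existsP; exists j; rewrite max_j eqxx connect0.
Qed.

Lemma kernel_closed : occ_closed (kernel_pos p).
Proof.
move=> a c b occ_t some_in.
have kerM i i' : in_occ i (a, c, b) -> in_occ i' (a, c, b) ->
    i \in kernel_pos p -> i' \in kernel_pos p.
  move=> it i't; rewrite !inE => /existsP[j /andP[max_j ji]].
  apply/existsP; exists j; rewrite max_j /=; apply: connect_trans ji _.
  pose t : {t | t \in perm_occ p} := Sub (a, c, b) occ_t.
  by apply: connect_trans (connect1 (_ : occ_graph (inl i) (inr t))) (connect1 _).
have [ha hc hb] : [/\ in_occ a (a, c, b), in_occ c (a, c, b) & in_occ b (a, c, b)].
  by rewrite /in_occ /= !eqxx !orbT.
by case/or3P: some_in => h; apply/and3P; split; apply: kerM h.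
Qed.

(** Together with [kernel_max] and [kernel_closed], this makes the kernel the least closed set
    containing the maximum, so later proofs need no paths in the graph. *)
Lemma kernel_min (X : {set 'I_n}) :
    (forall j, (p j).+1 = n -> j \in X) -> occ_closed X -> kernel_pos p \subset X.
Proof.
move=> maxX clX; apply/subsetP => i; rewrite inE => /existsP[j /andP[/eqP/maxX Xj]].
(* [X] is extended to occurrence vertices through their last entry; by [occX] any of the three
   entries gives the same answer. *)
pose A : pred ('I_n + {t | t \in perm_occ p}) :=
  fun u => match u with inl i => i \in X | inr t => (val t).2 \in X end.
have occX (t : {t | t \in perm_occ p}) i0 :
    in_occ i0 (val t) -> (i0 \in X) = ((val t).2 \in X).
  case: t => -[[a c] b] /= /clX; rewrite /in_occ /= => cl.
  have [eq_a eq_c] : (a \in X) = (b \in X) /\ (c \in X) = (b \in X).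
    by move: cl; do 3 case: (_ \in X) => //=; move/(_ isT).
  by case/or3P => /eqP->.
have clA : closed (@occ_graph n p) A.
  move=> [i1 | t1] [i2 | t2] //= /occX; rewrite !unfold_in /= => -> //.
move=> /(closed_connect clA) eqA.
by change (is_true (A (inl i))); rewrite -[A _]eqA.
Qed.

End Kernel.

(* Grow a set of entries from the maximum: each occurrence that leaves the set
   brings at most two new entries. *)
Lemma card_kernel_pos n (p : 'S_n) : #|kernel_pos p| <= 2 * #|perm_occ p| + 1.
Proof.
pose occ_in (A : {set 'I_n}) :=
  [set t in perm_occ p | [&& t.1.1 \in A, t.1.2 \in A & t.2 \in A]].
pose P (A : {set 'I_n}) :=
  (A \subset kernel_pos p) && (#|A| <= 2 * #|occ_in A| + 1).
pose A0 := [set j : 'I_n | (p j).+1 == n].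
have PA0 : P A0.
  apply/andP; split.
    by apply/subsetP => j; rewrite inE => /eqP; apply: kernel_max.
  apply: (@leq_trans 1); last by rewrite addn1.
  apply/card_le1_eqP => x y; rewrite !inE => /eqP max_x /eqP max_y.
  by apply: (@perm_inj _ p); apply: val_inj; apply: succn_inj;
  rewrite max_x max_y.
(* A maximal set with the bound replaces the iteration: an occurrence leaving it would give the
   larger set [B], again with the bound. *)
have [A /maxsetP[/andP[A_ker A_le] A_max] subA] := maxset_exists PA0.
suff kerA : kernel_pos p \subset A.
  apply: leq_trans (subset_leq_card kerA) (leq_trans A_le _).
  rewrite leq_add2r leq_mul2l /=; apply: subset_leq_card.
  by apply/subsetP => t; rewrite inE => /andP[].
apply: kernel_min => [j max_j | a c b occ_t some_in].
  by apply: (subsetP subA); rewrite inE max_j.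
have [//|not_all] := boolP [&& a \in A, c \in A & b \in A].
pose B := A :|: [set a; c; b].
have [Ba Bc Bb] : [/\ a \in B, c \in B & b \in B] by rewrite !inE !eqxx !orbT.
suff PB : P B by move: not_all; rewrite -(A_max B PB (subsetUl _ _)) Ba Bc Bb.
have ker_t : [|| a \in kernel_pos p, c \in kernel_pos p | b \in kernel_pos p].
  by case/or3P: some_in => /(subsetP A_ker) ->; rewrite ?orbT.
have /and3P[ka kc kb] := kernel_closed occ_t ker_t.
apply/andP; split.
  rewrite subUset A_ker; apply/subsetP => x.
  by rewrite !in_setU !in_set1 -orbA => /or3P[] /eqP->.
have card_B : #|B| <= #|A| + 2.
  rewrite cardsU; have le3 : #|[set a; c; b]| <= 3.
    by rewrite -setUA !cardsU1 cards1; do 2 case: (_ \notin _).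
  have gt0 : 0 < #|A :&: [set a; c; b]|.
    by apply/card_gt0P; case/or3P: some_in => Ax; [exists a | exists c | exists b];
      rewrite !inE Ax eqxx ?orbT.
  rewrite leq_subLR addnCA leq_add2l; apply: leq_trans le3 _.
  by rewrite (leq_add2r 2 1).
have arith x y z t : x <= 2 * z + 1 -> y <= x + 2 -> z < t -> y <= 2 * t + 1.
  by clear; lia.
apply: arith A_le card_B _.
apply: proper_card; apply/properP; split.
  apply/subsetP => t; rewrite !inE => /andP[-> /and3P[Aa Ac Ab]] /=.
  by rewrite Aa Ac Ab.
exists (a, c, b); first by rewrite inE occ_t /= Ba Bc Bb.
by rewrite inE occ_t.
Qed.

(** * Infeasibility as inequalities between natural numbers *)

Section Cells.
Variables (s : nat) (rho : 'S_s).

Lemma insert_half_at m l : insert_half rho m l l = (m%:R - 2^-1)%R.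
Proof. by rewrite /insert_half unlift_none. Qed.

Lemma insert_half_lift m l j : insert_half rho m l (lift l j) = (rho j)%:R%R.
Proof. by rewrite /insert_half liftK. Qed.

Lemma ltr_nat_half (a m : nat) : (a%:R < m%:R - 2^-1 :> rat)%R = (a < m).
Proof.
case: (ltnP a m) => am.
  have : ((a.+1)%:R <= m%:R :> rat)%R by rewrite ler_nat.
  rewrite -natr1; lra.
have : (m%:R <= a%:R :> rat)%R by rewrite ler_nat.
by move=> ma; apply/negbTE; rewrite -leNgt; lra.
Qed.

Lemma ltr_half_nat (a m : nat) : (m%:R - 2^-1 < a%:R :> rat)%R = (m <= a).
Proof.
case: (leqP m a) => am.
  have : (m%:R <= a%:R :> rat)%R by rewrite ler_nat.
  lra.
have : ((a.+1)%:R <= m%:R :> rat)%R by rewrite ler_nat.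
rewrite -natr1 => ma; apply/negbTE; rewrite -leNgt; lra.
Qed.

(* The three cases are those where the inserted entry plays 1, 3 and 2. *)
Definition cell_hit (m : 'I_s) (l : 'I_s.+1) (i i' : 'I_s) : bool :=
  [|| (l <= i < i') && (m <= rho i' < rho i),
      (i < l <= i') && (rho i < rho i' < m)
    | (i < i' < l) && (rho i < m <= rho i')].

(** Comparing a natural number with [m - 1/2] is a strict or weak comparison with [m], so the
    rational value disappears. *)
Lemma infeasibleP m l :
  reflect (exists i i', cell_hit m l i i') (infeasible rho (m, l)).
Proof.
have lift_lt i i' : (lift l i < lift l i') = (i < i') by rewrite /= /bump; lia.
have lift_gt i : (l < lift l i) = (l <= i) by rewrite /= /bump; lia.
have lift_le i : (lift l i < l) = (i < l) by rewrite /= /bump; lia.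
apply: (iffP existsP) => [[[[a c] b]] | [i [i']]].
  rewrite inE /in_occ /=.
  (* Each position of the triple is [l] or the lift of a kernel position; only the triples with
     exactly one [l] survive the simplification. *)
  case: (unliftP l a) => [i ->|->]; case: (unliftP l c) => [i' ->|->];
  case: (unliftP l b) => [i'' ->|->];
  rewrite ?insert_half_at ?insert_half_lift ?ltr_nat ?ltr_nat_half ?ltr_half_nat
          ?lift_lt ?lift_gt ?lift_le ?(negbTE (neq_lift _ _)) ?eqxx ?ltnn ?ltxx
          ?andbF //= ?andbT; case/and4P=> h1 h2 h3 h4.
  - by exists i, i'; rewrite /cell_hit h1 h2 h3 h4 !orbT.
  - by exists i, i''; rewrite /cell_hit h1 h2 h3 h4 !orbT.
  by exists i', i''; rewrite /cell_hit h1 h2 h3 h4.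
rewrite /cell_hit; case/or3P => /andP[/andP[h1 h2] /andP[h3 h4]].
- exists (l, lift l i, lift l i'); rewrite inE /in_occ /= eqxx andbT.
  by rewrite insert_half_at !insert_half_lift lift_lt lift_gt ltr_nat ltr_half_nat h1 h2 h3.
- exists (lift l i, l, lift l i'); rewrite inE /in_occ /= eqxx orbT andbT.
  by rewrite insert_half_at !insert_half_lift lift_le lift_gt ltr_nat ltr_nat_half h1 h2 h3.
exists (lift l i, lift l i', l); rewrite inE /in_occ /= eqxx !orbT andbT.
rewrite insert_half_at !insert_half_lift lift_le lift_lt.
by rewrite ltr_half_nat ltr_nat_half h1 h2 h3.
Qed.

End Cells.

(** * Inflations of a kernel permutation *)

Section FeasibleCells.
Variables (s : nat) (rho : 'S_s).
Hypothesis rho_conn : kernel_pos rho = [set: 'I_s].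

(* Without occurrences through the cell, the entries to its lower left are
   connected to no other entry, in particular not to the maximum. *)
Lemma feasible_lower_left m l (i : 'I_s) :
  ~~ infeasible rho (m, l) -> i < l -> m <= rho i.
Proof.
move=> feas lt_il; rewrite leqNgt; apply/negP => lt_im.
have no_hit i1 i2 : ~~ cell_hit rho m l i1 i2.
  by apply: contra feas => hit; apply/infeasibleP; exists i1, i2.
pose X := [set i : 'I_s | ~~ ((i < l) && (rho i < m))].
suff : kernel_pos rho \subset X.
  by move/subsetP/(_ i); rewrite rho_conn !inE lt_il lt_im => /(_ isT).
apply: kernel_min => [j max_j | a c b].
  rewrite inE negb_and -leqNgt; apply/orP; right; rewrite -leqNgt -ltnS max_j.
  exact: ltn_ord.
(* An occurrence with entries both inside and outside the lower left region contains two entries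
   that form a 132 with the inserted one. *)
rewrite perm_occE !inE.
move: (no_hit a c) (no_hit a b) (no_hit c b); rewrite /cell_hit.
move: (nat_of_ord a) (nat_of_ord b) (nat_of_ord c) (nat_of_ord (rho a)).
move: (nat_of_ord (rho b)) (nat_of_ord (rho c)) (nat_of_ord l) (nat_of_ord m).
clear; lia.
Qed.

(** If [m < m'], the kernel entry [v] at position [l] is left of the second cell, hence at least
    [m'], while the entry [w] of value [m] must be at or after [l']. Then the first cell, [v] and
    [w] form a 132. *)
Lemma feasible_antitone m l m' l' :
    ~~ infeasible rho (m, l) -> ~~ infeasible rho (m', l') -> l < l' ->
  m' <= m.
Proof.
move=> feas feas' lt_ll'; rewrite leqNgt; apply/negP => lt_mm'.
have lt_ls : l < s by rewrite (leq_trans lt_ll') // -ltnS ltn_ord.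
pose v : 'I_s := Ordinal lt_ls; pose w : 'I_s := (rho^-1)%g m.
have rho_w : rho w = m by rewrite permKV.
have le_v : m' <= rho v by apply: feasible_lower_left feas' _.
have le_w : l' <= w.
  rewrite leqNgt; apply/negP => /(feasible_lower_left feas').
  by rewrite rho_w leqNgt lt_mm'.
case/negP: feas; apply/infeasibleP; exists v, w.
by rewrite /cell_hit /= leqnn (leq_trans lt_ll') //= rho_w leqnn (leq_trans lt_mm').
Qed.

End FeasibleCells.

Section Inflation.
Variables (s : nat) (rho : 'S_s).
Let F := feasible_count rho.
Let cells := [set c : 'I_s * 'I_s.+1 | ~~ infeasible rho c].

(** The type ascription is a conversion, since [feasible_count rho] unfolds to [#|cells|]. *)
Definition cell_row (j : 'I_F) : 'I_s := (enum_val (j : 'I_#|cells|)).1.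
Definition cell_col (j : 'I_F) : 'I_s.+1 := (enum_val (j : 'I_#|cells|)).2.

Lemma cell_feasible j : ~~ infeasible rho (cell_row j, cell_col j).
Proof.
have := enum_valP (j : 'I_#|cells|).
by rewrite inE /cell_row /cell_col; case: (enum_val _).
Qed.

Lemma cell_inj j j' :
  cell_row j = cell_row j' -> cell_col j = cell_col j' -> j = j'.
Proof.
rewrite /cell_row /cell_col => eq_row eq_col; apply: (@enum_val_inj _ (mem cells)).
by move: eq_row eq_col; case: (enum_val _) (enum_val _) => m l [m' l'] /= -> ->.
Qed.

Lemma cell_exists m l : ~~ infeasible rho (m, l) ->
  exists j, cell_row j = m /\ cell_col j = l.
Proof.
move=> feas; have cells_ml : (m, l) \in cells by rewrite inE.
by exists (enum_rank_in cells_ml (m, l)); rewrite /cell_row /cell_col enum_rankK_in.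
Qed.

Variables (N : nat) (h : {ffun 'I_F -> {k : 'I_N.+1 & 'S_k}}).

Definition part (o : option 'I_F) : {k : nat & 'S_k} :=
  if o is Some j then Tagged (fun k => 'S_k) (tagged (h j))
  else Tagged (fun k => 'S_k) rho.

(* [None] indexes the kernel and [Some j] the j-th feasible cell. *)
Definition points := {o : option 'I_F & 'I_(tag (part o))}.

Definition kernel_pt (i : 'I_s) : points :=
  Tagged (fun o => 'I_(tag (part o))) (i : 'I_(tag (part None))).

Definition cell_pt j (u : 'I_(tag (h j))) : points :=
  Tagged (fun o => 'I_(tag (part o))) (u : 'I_(tag (part (Some j)))).

Lemma pointsP (Q : points -> Prop) :
  (forall i, Q (kernel_pt i)) -> (forall j u, Q (@cell_pt j u)) -> forall x, Q x.
Proof. by move=> Qk Qc [[j|] u]; [apply: Qc | apply: Qk]. Qed.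

(* Lexicographic order in base N + s + 2.  Kernel entries get odd first digits and
   cells even ones; cells in a common column are read from top to bottom, and
   those in a common row rise from right to left. *)
Definition key a b c := (a * (N + s).+2 + b) * (N + s).+2 + c.

Lemma key_ltn a b c a' b' c' : maxn b c < (N + s).+2 -> maxn b' c' < (N + s).+2 ->
  (key a b c < key a' b' c') =
  (a < a') || (a == a') && ((b < b') || (b == b') && (c < c')).
Proof.
rewrite /key; move: (N + s).+2 => B; rewrite !gtn_max => /andP[bB cB] /andP[b'B c'B].
have lexE x y x' y' : y < B -> y' < B ->
    (x * B + y < x' * B + y') = (x < x') || (x == x') && (y < y').
  by clear; move=> *; case: (ltngtP x x') => [||->]; nia.
have eqE x y x' y' : y < B -> y' < B ->
    (x * B + y == x' * B + y') = (x == x') && (y == y').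
  by clear; move=> *; case: (ltngtP x x') => [||->]; nia.
rewrite lexE // lexE // eqE //; move: (a == a') (a < a') => [] [] //=.
Qed.

Definition pos_key (x : points) : nat :=
  if tag x is Some j then key (cell_col j).*2 (s - cell_row j) (tagged x)
  else key (tagged x).*2.+1 0 0.

Definition val_key (x : points) : nat :=
  let v := nat_of_ord (tagged (part (tag x)) (tagged x)) in
  if tag x is Some j then key (cell_row j).*2 (s - cell_col j) v
  else key v.*2.+1 0 0.

Let small_pos j (u : 'I_(tag (h j))) : maxn (s - cell_row j) u < (N + s).+2.
Proof.
have := leq_trans (ltn_ord u) (ltnSE (ltn_ord (tag (h j)))); rewrite gtn_max.
by move: (nat_of_ord u) => x; lia.
Qed.

Let small_val j (u : 'I_(tag (h j))) : maxn (s - cell_col j) u < (N + s).+2.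
Proof.
have := leq_trans (ltn_ord u) (ltnSE (ltn_ord (tag (h j)))); rewrite gtn_max.
by move: (nat_of_ord u) => x; lia.
Qed.

Lemma pos_kk i i' : (pos_key (kernel_pt i) < pos_key (kernel_pt i')) = (i < i').
Proof. by rewrite key_ltn //= andbF orbF; lia. Qed.

Lemma pos_kc i j (u : 'I_(tag (h j))) :
  (pos_key (kernel_pt i) < pos_key (cell_pt u)) = (i < cell_col j).
Proof. by rewrite key_ltn //=; move: (cell_col j) (cell_row j) => l m; lia. Qed.

Lemma pos_ck i j (u : 'I_(tag (h j))) :
  (pos_key (cell_pt u) < pos_key (kernel_pt i)) = (cell_col j <= i).
Proof. by rewrite key_ltn //=; move: (cell_col j) (cell_row j) => l m; lia. Qed.

Lemma pos_cc j (u v : 'I_(tag (h j))) :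
  (pos_key (cell_pt u) < pos_key (cell_pt v)) = (u < v).
Proof. by rewrite key_ltn //= !ltnn !eqxx. Qed.

Lemma pos_cc' j j' (u : 'I_(tag (h j))) (v : 'I_(tag (h j'))) : j != j' ->
  (pos_key (cell_pt u) < pos_key (cell_pt v)) =
  (cell_col j < cell_col j') ||
  (cell_col j == cell_col j' :> nat) && (cell_row j' < cell_row j).
Proof.
move=> neq_j; rewrite key_ltn //=.
have : ~~ ((cell_row j == cell_row j' :> nat) && (cell_col j == cell_col j' :> nat)).
  by apply: contra neq_j => /andP[/eqP/val_inj? /eqP/val_inj?]; apply/eqP/cell_inj.
have := ltn_ord (cell_row j); have := ltn_ord (cell_row j').
move: (nat_of_ord (cell_row j)) (nat_of_ord (cell_row j')).
move: (nat_of_ord (cell_col j)) (nat_of_ord (cell_col j')) (u < v).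
by clear; lia.
Qed.

Lemma val_kk i i' :
  (val_key (kernel_pt i) < val_key (kernel_pt i')) = (rho i < rho i').
Proof. by rewrite key_ltn //= andbF orbF; lia. Qed.

Lemma val_kc i j (u : 'I_(tag (h j))) :
  (val_key (kernel_pt i) < val_key (cell_pt u)) = (rho i < cell_row j).
Proof. by rewrite key_ltn //=; move: (cell_col j) (cell_row j) => l m; lia. Qed.

Lemma val_ck i j (u : 'I_(tag (h j))) :
  (val_key (cell_pt u) < val_key (kernel_pt i)) = (cell_row j <= rho i).
Proof. by rewrite key_ltn //=; move: (cell_col j) (cell_row j) => l m; lia. Qed.

Lemma val_cc j (u v : 'I_(tag (h j))) :
  (val_key (cell_pt u) < val_key (cell_pt v)) =
  (tagged (h j) u < tagged (h j) v).
Proof. by rewrite key_ltn //= !ltnn !eqxx. Qed.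

Lemma val_cc' j j' (u : 'I_(tag (h j))) (v : 'I_(tag (h j'))) : j != j' ->
  (val_key (cell_pt u) < val_key (cell_pt v)) =
  (cell_row j < cell_row j') ||
  (cell_row j == cell_row j' :> nat) && (cell_col j' < cell_col j).
Proof.
move=> neq_j; rewrite key_ltn //=.
have : ~~ ((cell_row j == cell_row j' :> nat) && (cell_col j == cell_col j' :> nat)).
  by apply: contra neq_j => /andP[/eqP/val_inj? /eqP/val_inj?]; apply/eqP/cell_inj.
have := ltn_ord (cell_col j); have := ltn_ord (cell_col j').
move: (nat_of_ord (cell_row j)) (nat_of_ord (cell_row j')).
move: (nat_of_ord (cell_col j)) (nat_of_ord (cell_col j')).
move: (tagged (h j) u < tagged (h j') v).
by clear; lia.
Qed.

Lemma pos_key_inj : injective pos_key.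
Proof.
move=> x y eq_xy; have : ~~ (pos_key x < pos_key y) by rewrite eq_xy ltnn.
have : ~~ (pos_key y < pos_key x) by rewrite eq_xy ltnn.
elim/pointsP: x {eq_xy} => [i | j u]; elim/pointsP: y => [i' | j' u'];
  rewrite ?pos_kk ?pos_kc ?pos_ck.
- by move=> le1 le2; congr kernel_pt; apply: val_inj => /=; lia.
- by lia.
- by lia.
case: (eqVneq j j') u u' => [<- | neq_j] u u'.
  by rewrite !pos_cc => le1 le2; congr cell_pt; apply: val_inj => /=; lia.
have neq_j' : j' != j by rewrite eq_sym.
rewrite (pos_cc' _ _ neq_j) (pos_cc' _ _ neq_j').
have : ~~ ((cell_row j == cell_row j' :> nat) && (cell_col j == cell_col j' :> nat)).
  by apply: contra neq_j => /andP[/eqP/val_inj? /eqP/val_inj?]; apply/eqP/cell_inj.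
by lia.
Qed.

Lemma val_key_inj : injective val_key.
Proof.
move=> x y eq_xy; have : ~~ (val_key x < val_key y) by rewrite eq_xy ltnn.
have : ~~ (val_key y < val_key x) by rewrite eq_xy ltnn.
elim/pointsP: x {eq_xy} => [i | j u]; elim/pointsP: y => [i' | j' u'];
  rewrite ?val_kk ?val_kc ?val_ck.
- move=> le1 le2; congr kernel_pt; apply: (@perm_inj _ rho).
  by apply: val_inj => /=; lia.
- by lia.
- by lia.
case: (eqVneq j j') u u' => [<- | neq_j] u u'.
  rewrite !val_cc => le1 le2; congr cell_pt; apply: (@perm_inj _ (tagged (h j))).
  by apply: val_inj => /=; lia.
have neq_j' : j' != j by rewrite eq_sym.
rewrite (val_cc' _ _ neq_j) (val_cc' _ _ neq_j').
have : ~~ ((cell_row j == cell_row j' :> nat) && (cell_col j == cell_col j' :> nat)).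
  by apply: contra neq_j => /andP[/eqP/val_inj? /eqP/val_inj?]; apply/eqP/cell_inj.
by lia.
Qed.

End Inflation.

Lemma big_option (R : Type) (idx : R) (op : Monoid.com_law idx) (I : finType)
    (f : option I -> R) :
  \big[op/idx]_o f o = op (f None) (\big[op/idx]_i f (Some i)).
Proof.
rewrite (bigD1 None) //=; congr (op _ _).
rewrite (reindex_omap Some id) => [|[i|]] //=.
by apply: eq_bigl => i; rewrite eqxx.
Qed.

(** * Kernel, cell contents and occurrences of an inflation *)

Section Inflates.
Variables (s : nat) (rho : 'S_s).
Hypotheses (s_gt0 : 0 < s) (rho_conn : kernel_pos rho = [set: 'I_s]).
Variables (N : nat) (h : {ffun 'I_(feasible_count rho) -> {k : 'I_N.+1 & 'S_k}}).

Lemma card_points : #|{: points h}| = s + \sum_j tag (h j).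
Proof.
rewrite card_tagged sumnE big_map big_enum /= big_option /= card_ord.
by congr addn; apply: eq_bigr => j _; rewrite card_ord.
Qed.

(** This relation between [p] and [h] is the bijection behind the count; [e] places the points in
    [p], and only comparisons of keys matter. *)
Definition inflates n (p : 'S_n) (e : points h -> 'I_n) : Prop :=
  [/\ bijective e, forall x y, (e x < e y) = (pos_key x < pos_key y)
    & forall x y, (p (e x) < p (e y)) = (val_key x < val_key y)].

(** Positions are the ranks of [pos_key], and [p] standardizes [val_key] read in that order. *)
Lemma inflation_exists n : #|{: points h}| = n ->
  exists (p : 'S_n) e, inflates p e.
Proof.
move=> cardP; have [e e_mono] := rank_exists (@pos_key_inj _ _ _ h) cardP.
have e_bij : bijective e.
  apply: inj_card_bij; last by rewrite card_ord cardP.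
  by move=> x y eq_e; apply: (inj_of_mono_ltn (@pos_key_inj _ _ _ h) e_mono); rewrite eq_e.
case: (e_bij) => e' eK e'K.
have [p pE] := std_exists (inj_comp (@val_key_inj _ _ _ h) (can_inj e'K)).
by exists p, e; split=> // x y; rewrite pE /= !eK.
Qed.

Variables (n : nat) (p : 'S_n) (e : points h -> 'I_n).
Hypothesis infl : inflates p e.

Let e_inj : injective e. Proof. by case: infl => /bij_inj. Qed.
Let e_surj i : exists x, e x = i.
Proof. by case: infl => -[e' _ e'K] _ _; exists (e' i). Qed.
Let e_pos x y : (e x < e y) = (pos_key x < pos_key y). Proof. by case: infl. Qed.
Let e_val x y : (p (e x) < p (e y)) = (val_key x < val_key y).
Proof. by case: infl. Qed.

(** A feasible cell lies below the kernel entries on its left, so a kernel entry is never the 1 of a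
    132 whose 2 or 3 lies in a cell. *)
Lemma kernel_cell_not_increasing i j (u : 'I_(tag (h j))) :
  e (kernel_pt h i) < e (cell_pt u) -> p (e (cell_pt u)) < p (e (kernel_pt h i)).
Proof.
rewrite e_pos e_val pos_kc val_ck.
by move=> lt_i; have := feasible_lower_left rho_conn (cell_feasible j) lt_i.
Qed.

Lemma cell_cell_not_increasing j j' (u : 'I_(tag (h j))) (v : 'I_(tag (h j'))) :
    j != j' -> e (cell_pt u) < e (cell_pt v) ->
  p (e (cell_pt u)) < p (e (cell_pt v)) -> False.
Proof.
move=> neq_j; rewrite e_pos e_val pos_cc' // val_cc' //.
have := feasible_antitone rho_conn (cell_feasible j) (cell_feasible j').
move: (nat_of_ord (cell_row j)) (nat_of_ord (cell_row j')).
move: (nat_of_ord (cell_col j)) (nat_of_ord (cell_col j')).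
clear; lia.
Qed.

(** The 1 forms an increasing pair with each other entry, so a kernel 1 forces kernel entries, and a
    1 in a cell leaves only that cell and the kernel. A single kernel entry would separate two
    entries of one cell by position or by value; two would make the cell infeasible. *)
Lemma occ_in_part x y z : (e x, e y, e z) \in perm_occ p ->
  tag y = tag x /\ tag z = tag x.
Proof.
rewrite perm_occE => /and4P[xy yz xz zy]; have xz' := ltn_trans xy yz.
have xy' := ltn_trans xz zy.
elim/pointsP: x => [i | j u] in xy xz xz' xy' *.
  elim/pointsP: y => [i' | j u] in xy xy' yz zy *; last first.
    by have := kernel_cell_not_increasing xy; rewrite ltnNge ltnW.
  elim/pointsP: z => [i'' | j u] in xz xz' yz zy *; first by [].
  by have := kernel_cell_not_increasing xz'; rewrite ltnNge ltnW.
elim/pointsP: y => [i | j' v] in xy xy' yz zy *; last first.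
  have [eq_j | neq_j] := eqVneq j j'; last first.
    by case: (cell_cell_not_increasing neq_j xy xy').
  elim/pointsP: z => [i'' | j'' w] in xz xz' yz zy *; last first.
    have [eq_j' | neq_j'] := eqVneq j j''; first by split; congr Some.
    by case: (cell_cell_not_increasing neq_j' xz' xz).
  exfalso; move: xz zy; rewrite !e_val val_ck val_kc eq_j => le_ji.
  by rewrite ltnNge le_ji.
elim/pointsP: z => [i' | j' v] in xz xz' yz zy *; last first.
  have [eq_j | neq_j] := eqVneq j j'; last first.
    by case: (cell_cell_not_increasing neq_j xz' xz).
  by exfalso; move: xy yz; rewrite !e_pos pos_ck pos_kc eq_j leqNgt => /negbTE->.
move: xy yz xz zy; rewrite !e_pos !e_val pos_ck val_ck pos_kk val_kk => h1 h2 h3 h4.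
case/negP: (cell_feasible j); apply/infeasibleP; exists i, i'.
by rewrite /cell_hit h1 h2 h3 h4.
Qed.

(** Both inclusions use [kernel_min]: the image is closed by [occ_in_part], and the preimage of the
    kernel of [p] is closed in the connected [rho]. *)
Lemma kernel_pos_inflation : kernel_pos p = [set e (kernel_pt h i) | i : 'I_s].
Proof.
(* Rows are smaller than [s], so the largest kernel entry lies above every cell and is the maximum
   of [p]. *)
have max_lt (t : nat) : t < s -> exists2 i, (rho i).+1 = s & t <= rho i.
  move=> lt_ts; have lt_s : s.-1 < s by rewrite prednK.
  exists ((rho^-1)%g (Ordinal lt_s)); rewrite permKV /= ?prednK //.
  by rewrite -ltnS prednK.
have max_kernel i : (p i).+1 = n ->
    exists2 i0, (rho i0).+1 = s & e (kernel_pt h i0) = i.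
  have [x <-] := e_surj i; elim/pointsP: x => [i0 | j u] max_i.
    have [i1 max_i1 le_i] := max_lt _ (ltn_ord (rho i0)).
    exists i0 => //; move: le_i; rewrite leq_eqVlt => /orP[/eqP-> // | lt_i].
    have : p (e (kernel_pt h i0)) < p (e (kernel_pt h i1)) by rewrite e_val val_kk.
    by rewrite -ltnS max_i ltnNge ltn_ord.
  have [i1 max_i1 le_i] := max_lt _ (ltn_ord (cell_row j)).
  have : p (e (cell_pt u)) < p (e (kernel_pt h i1)) by rewrite e_val val_ck.
  by rewrite -ltnS max_i ltnNge ltn_ord.
have im_tag x : (e x \in [set e (kernel_pt h i) | i : 'I_s]) = (tag x == None).
  apply/imsetP/eqP => [[i _ /e_inj -> //] | ].
  by elim/pointsP: x => // i _; exists i.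
apply/eqP; rewrite eqEsubset; apply/andP; split.
  apply: kernel_min => [i /max_kernel[i0 _ <-] | a c b].
    by apply/imsetP; exists i0.
  have [x <-] := e_surj a; have [y <-] := e_surj c; have [z <-] := e_surj b.
  by move=> /occ_in_part[eq_y eq_z]; rewrite !im_tag eq_y eq_z !orbb !andbb.
pose X := [set i | e (kernel_pt h i) \in kernel_pos p].
have XE i : (i \in X) = (e (kernel_pt h i) \in kernel_pos p) by rewrite [LHS]in_set.
suff kerX : kernel_pos rho \subset X.
  apply/subsetP => _ /imsetP[i _ ->].
  by have := subsetP kerX i; rewrite rho_conn XE in_setT => /(_ isT).
apply: kernel_min => [i max_i | a c b occ_t].
  have n_gt0 : 0 < n by apply: leq_ltn_trans (ltn_ord (e (kernel_pt h i))).
  have lt_n : n.-1 < n by rewrite prednK.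
  pose i1 := (p^-1)%g (Ordinal lt_n).
  have max_i1 : (p i1).+1 = n by rewrite permKV /= prednK.
  have [i0 max_i0 eq_i1] := max_kernel _ max_i1.
  have -> : i = i0.
    by apply: (@perm_inj _ rho); apply: val_inj; apply: succn_inj; rewrite max_i max_i0.
  by rewrite XE eq_i1 kernel_max.
rewrite !XE; apply: kernel_closed; move: occ_t.
by rewrite !perm_occE !e_pos !e_val !pos_kk !val_kk.
Qed.

Lemma embeds_kernel : embeds p (kernel_pos p) rho (fun i => e (kernel_pt h i)).
Proof.
split=> [u v | u v |]; rewrite ?e_pos ?e_val ?pos_kk ?val_kk //.
by rewrite kernel_pos_inflation; apply/setP => i;
   apply/imsetP/imsetP => -[u _ ->]; exists u.
Qed.

(** Stated through the kernel embedding [k] alone, without [h], so that the contents of the cells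
    can be recovered from [p]. *)
Definition cell_entries (k : 'I_s -> 'I_n) (j : 'I_(feasible_count rho)) :=
  [set i | (i \notin kernel_pos p) &&
     [forall w, ((k w < i) == (w < cell_col j))
                && ((p (k w) < p i) == (rho w < cell_row j))]].

(** Rows are kernel values, and the smaller of two distinct columns is at most [s - 1], hence a
    kernel position; these entries tell the cells apart. *)
Lemma separated_cells (j j' : 'I_(feasible_count rho)) :
    (forall w : 'I_s, (w < cell_col j) = (w < cell_col j')) ->
    (forall w : 'I_s, (rho w < cell_row j) = (rho w < cell_row j')) -> j = j'.
Proof.
move=> eq_col eq_row; apply: cell_inj; apply: val_inj => /=.
  have := eq_row ((rho^-1)%g (cell_row j)); have := eq_row ((rho^-1)%g (cell_row j')).
  by rewrite !permKV; clear; lia.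
case: (ltngtP (cell_col j) (cell_col j')) => // lt_c.
  have lt_s : cell_col j < s by rewrite (leq_trans lt_c) // -ltnS.
  by have := eq_col (Ordinal lt_s); rewrite /= lt_c ltnn.
have lt_s : cell_col j' < s by rewrite (leq_trans lt_c) // -ltnS.
by have := eq_col (Ordinal lt_s); rewrite /= lt_c ltnn.
Qed.

Lemma embeds_cell j :
  embeds p (cell_entries (fun i => e (kernel_pt h i)) j) (tagged (h j))
    (fun u => e (cell_pt u)).
Proof.
split=> [u v | u v |]; rewrite ?e_pos ?e_val ?pos_cc ?val_cc //.
apply/setP => i; rewrite in_set; apply/andP/imsetP => [[] | [u _ ->]].
  have [x <-] := e_surj i; elim/pointsP: x => [i0 | j' u].
    by rewrite kernel_pos_inflation => /negP[]; apply/imsetP; exists i0.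
  move=> _ /forallP cell_u.
  suff eq_j : j = j' by subst j'; exists u.
  by apply: separated_cells => w; have /andP[/eqP eq1 /eqP eq2] := cell_u w;
    rewrite -?eq1 -?eq2 ?e_pos ?e_val ?pos_kc ?val_kc.
split; last by apply/forallP => w; rewrite e_pos e_val pos_kc val_kc !eqxx.
by rewrite kernel_pos_inflation; apply/imsetP => -[i0 _ /e_inj].
Qed.

(** By [occ_in_part] the occurrences split over the parts, and inside a part the keys compare as in
    its own permutation. *)
Lemma card_perm_occ_inflation :
  #|perm_occ p| = capacity rho + \sum_j #|perm_occ (tagged (h j))|.
Proof.
transitivity (\sum_o #|perm_occ (tagged (part h o))|); last first.
  by rewrite big_option.
have part_pos o (u v : 'I_(tag (part h o))) :
    (e (Tagged _ u) < e (Tagged _ v)) = (u < v).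
  by rewrite e_pos; case: o u v => [j|] u v; rewrite (pos_cc, pos_kk).
have part_val o (u v : 'I_(tag (part h o))) :
    (p (e (Tagged _ u)) < p (e (Tagged _ v)))
    = (tagged (part h o) u < tagged (part h o) v).
  by rewrite e_val; case: o u v => [j|] u v; rewrite (val_cc, val_kk).
pose T o : finType := ('I_(tag (part h o)) * 'I_(tag (part h o)) * 'I_(tag (part h o)))%type.
pose f (x : {o & T o}) :=
  let pt u := e (Tagged (fun o => 'I_(tag (part h o))) u) in
  (pt (tagged x).1.1, pt (tagged x).1.2, pt (tagged x).2).
have f_inj : injective f.
  move=> [o [[a c] b]] [o' [[a' c'] b']] [/e_inj eq_a /e_inj eq_c /e_inj eq_b].
  have eq_o : o = o' := congr1 tag eq_a.
  subst o'; move: eq_a eq_c eq_b => /eqP + /eqP + /eqP.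
  by rewrite !eq_Tagged /= => /eqP-> /eqP-> /eqP->.
transitivity #|[set x : {o & T o} | tagged x \in perm_occ (tagged (part h (tag x)))]|.
  rewrite -(card_imset _ f_inj); apply: eq_card => -[[a c] b].
  apply/idP/imsetP => [| [[o [[a' c'] b']]]]; last first.
    rewrite in_set /= !perm_occE => occ_t [-> -> ->].
    by rewrite !part_pos !part_val.
  have [x <-] := e_surj a; have [y <-] := e_surj c; have [z <-] := e_surj b.
  case: x y z => [o u] [o' v] [o'' w] occ_t.
  have [/= eq1 eq2] := occ_in_part occ_t; subst o' o''.
  exists (Tagged T (u, v, w)) => //; rewrite in_set /= perm_occE.
  by move: occ_t; rewrite perm_occE !part_pos !part_val.
rewrite -sum1_card; under [RHS]eq_bigr => o _ do rewrite -sum1_card.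
rewrite (sig_big_dep _ _ (fun o t => 1)) /=.
by apply: eq_bigl => x; rewrite in_set.
Qed.

End Inflates.

(** * Every nonempty permutation inflates its kernel shape *)

Section KernelShapes.
Variables (n : nat) (p : 'S_n) (s : nat) (rho : 'S_s) (k : 'I_s -> 'I_n).
Hypothesis emb : embeds p (kernel_pos p) rho k.

Let k_pos u v : (k u < k v) = (u < v). Proof. by case: emb. Qed.
Let k_val u v : (p (k u) < p (k v)) = (rho u < rho v). Proof. by case: emb. Qed.
Let k_kernel u : k u \in kernel_pos p.
Proof. by case: emb => _ _ ->; apply: imset_f. Qed.
Let kernel_k i : i \in kernel_pos p -> exists u, i = k u.
Proof. by case: (emb) => _ _ {1}-> /imsetP[u _ ->]; exists u. Qed.

Lemma kernel_shape_max u : (p (k u)).+1 = n -> (rho u).+1 = s.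
Proof.
move=> max_u; have s_gt0 : 0 < s by apply: leq_ltn_trans (ltn_ord u).
have lt_s : s.-1 < s by rewrite prednK.
apply/eqP; rewrite eqn_leq ltn_ord /= leqNgt; apply/negP => lt_u.
have : p (k u) < p (k ((rho^-1)%g (Ordinal lt_s))).
  by rewrite k_val permKV /= -ltnS prednK.
by rewrite -ltnS max_u ltnNge ltn_ord.
Qed.

(** An occurrence of [p] meeting the image of the kernel of [rho] lies in the kernel of [p], hence
    comes from [rho]. So this image is closed, and [kernel_min] applies. *)
Lemma kernel_shape_conn : kernel_pos rho = [set: 'I_s].
Proof.
apply/eqP; rewrite eqEsubset subsetT; apply/subsetP => u _.
have k_inj : injective k := embeds_inj emb.
have memk v : (k v \in k @: kernel_pos rho) = (v \in kernel_pos rho).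
  exact: mem_imset.
rewrite -memk; apply: (subsetP _ _ (k_kernel u)).
apply: kernel_min => [j max_j | a c b occ_t some_in].
  have [v def_j] := kernel_k (kernel_max max_j).
  by rewrite def_j memk kernel_max // kernel_shape_max // -def_j.
have /and3P[] : [&& a \in kernel_pos p, c \in kernel_pos p & b \in kernel_pos p].
  apply: kernel_closed occ_t _.
  by case/or3P: some_in => /imsetP[v _ ->]; rewrite k_kernel ?orbT.
move=> /kernel_k[a' def_a] /kernel_k[c' def_c] /kernel_k[b' def_b].
move: occ_t some_in; rewrite def_a def_c def_b !memk => occ_t.
apply: kernel_closed; move: occ_t.
by rewrite !perm_occE !k_pos !k_val.
Qed.

Lemma initial_segment (D : pred 'I_s) :
    (forall u v : 'I_s, u < v -> D v -> D u) ->
  exists l : 'I_s.+1, forall u, D u = (u < l).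
Proof.
move=> D_down; have [v nDv | allD] := pickP (predC D); last first.
  by exists ord_max => u; rewrite ltn_ord; apply/negbNE/negbT/allD.
case: (arg_minnP (fun u : 'I_s => u : nat) nDv) => l nDl min_l.
exists (widen_ord (leqnSn s) l) => u /=; apply/idP/idP => [Du | lt_ul].
  rewrite ltnNge leq_eqVlt; apply/negP => /orP[/eqP/val_inj eq_lu | lt_lu].
    by move: nDl; rewrite /= eq_lu Du.
  by move: nDl; rewrite /= (D_down _ _ lt_lu Du).
by apply: contraLR lt_ul => nDu; rewrite -leqNgt; apply: min_l.
Qed.

Hypothesis n_gt0 : 0 < n.

Let max_kernel : exists u, (p (k u)).+1 = n.
Proof.
have lt_n : n.-1 < n by rewrite prednK.
have max_j : (p ((p^-1)%g (Ordinal lt_n))).+1 = n by rewrite permKV /= prednK.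
by have [u def_j] := kernel_k (kernel_max max_j); exists u; rewrite -def_j.
Qed.

Lemma kernel_shape_gt0 : 0 < s.
Proof. by case: max_kernel => u _; apply: leq_ltn_trans (ltn_ord u). Qed.

Let no_mixed_occ x y z : (x, y, z) \in perm_occ p ->
  [&& x \in kernel_pos p, y \in kernel_pos p & z \in kernel_pos p] ||
  [&& x \notin kernel_pos p, y \notin kernel_pos p & z \notin kernel_pos p].
Proof.
by move=> /kernel_closed; do 3 case: (_ \in kernel_pos p) => //=; move/(_ isT).
Qed.

Let neq_kernel i u : i \notin kernel_pos p ->
  ((i < k u) = ~~ (k u < i)) * ((p i < p (k u)) = ~~ (p (k u) < p i)).
Proof.
move=> ker'i; have neq_i : k u != i by apply: contraNneq ker'i => <-.
rewrite -!leqNgt !ltn_neqAle !(inj_eq val_inj) (inj_eq perm_inj) eq_sym.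
by rewrite neq_i.
Qed.

Lemma cell_of_entry i : i \notin kernel_pos p ->
  exists j : 'I_(feasible_count rho), i \in cell_entries p k j.
Proof.
move=> ker'i.
have [l lE] : exists l : 'I_s.+1, forall u, (k u < i) = (u < l).
  apply: initial_segment => u v lt_uv; apply: ltn_trans.
  by rewrite k_pos.
have [m' m'E] : exists m : 'I_s.+1,
    forall u, (p (k ((rho^-1)%g u)) < p i) = (u < m).
  apply: initial_segment => u v lt_uv; apply: ltn_trans.
  by rewrite k_val !permKV.
have mE u : (p (k u) < p i) = (rho u < m') by rewrite -m'E permK.
(* There is no row [s]: the maximum of [p] is a kernel entry, so [p i] is below some kernel
   entry. *)
have lt_ms : m' < s.
  have [u max_u] := max_kernel; apply: leq_ltn_trans (ltn_ord (rho u)).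
  rewrite leqNgt -mE; have := neq_kernel u ker'i; case=> _ <-.
  have : p i <= p (k u) by rewrite -ltnS max_u.
  rewrite leq_eqVlt => /orP[/eqP/val_inj/perm_inj eq_i | //].
  by rewrite eq_i k_kernel in ker'i.
have feas : ~~ infeasible rho (Ordinal lt_ms, l).
  (* With [i] as the inserted entry, a hit is an occurrence of [p] with entries both inside and
     outside the kernel. *)
  apply/negP => /infeasibleP[u [v]]; rewrite /cell_hit /= => hit.
  have [x [y [z [occ_t i_in k_in]]]] : exists x y z,
      [/\ (x, y, z) \in perm_occ p, [|| i == x, i == y | i == z]
        & [|| k u == x, k u == y | k u == z]].
    case/or3P: hit => /andP[/andP[h1 h2] /andP[h3 h4]].
    - exists i, (k u), (k v); rewrite !eqxx !orbT perm_occE k_pos k_val h2 h4.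
      by rewrite !neq_kernel // lE mE -!leqNgt h1 h3.
    - exists (k u), i, (k v); rewrite !eqxx !orbT perm_occE k_val lE h1 h3.
      by rewrite neq_kernel // lE mE h4 -leqNgt h2.
    exists (k u), (k v), i; rewrite !eqxx !orbT perm_occE k_pos lE h1 h2.
    by rewrite mE neq_kernel // mE h3 -leqNgt h4.
  have := no_mixed_occ occ_t; case/orP => /and3P[kx ky kz].
    by move: i_in ker'i; case/or3P => /eqP->; rewrite (kx, ky, kz).
  by move: k_in (k_kernel u); case/or3P => /eqP->; rewrite (negPf kx, negPf ky, negPf kz).
have [j [row_j col_j]] := cell_exists feas; exists j.
rewrite in_set ker'i; apply/forallP => w.
by rewrite row_j col_j lE mE !eqxx.
Qed.

(** [h] collects the patterns on the sets [cell_entries], and [e] glues their embeddings to [k]. The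
    order between different cells is forced, because a violation would create an occurrence mixing
    kernel and other entries. *)
Lemma kernel_shape_inflates :
  exists (h : {ffun 'I_(feasible_count rho) -> {m : 'I_n.+1 & 'S_m}}) e,
    inflates (h := h) p e.
Proof.
have rho_conn := kernel_shape_conn.
have [h hP] : exists h : {ffun 'I_(feasible_count rho) -> {m : 'I_n.+1 & 'S_m}},
    forall j, exists e, embeds p (cell_entries p k j) (tagged (h j)) e.
  suff [f fP] : exists f : 'I_(feasible_count rho) -> {m : 'I_n.+1 & 'S_m},
      forall j, exists e, embeds p (cell_entries p k j) (tagged (f j)) e.
    by exists (finfun f) => j; rewrite ffunE.
  apply: (@fin_all_exists _ (fun=> {m : 'I_n.+1 & 'S_m})
    (fun j x => exists e, embeds p (cell_entries p k j) (tagged x) e)) => j.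
  have [q [e emb_j]] := embeds_exists p (cell_entries p k j).
  have lt_n : #|cell_entries p k j| < n.+1 
    by have := max_card (mem (cell_entries p k j)); rewrite card_ord ltnS.
  by exists (Tagged (fun m : 'I_n.+1 => 'S_m) (q : 'S_(Ordinal lt_n))), e.
have {hP} [c cP] : exists c : forall j, 'I_(tag (h j)) -> 'I_n,
    forall j, embeds p (cell_entries p k j) (tagged (h j)) (c j).
  by apply: (@fin_all_exists _ (fun j => 'I_(tag (h j)) -> 'I_n)
    (fun j c => embeds p (cell_entries p k j) (tagged (h j)) c)).
pose e (x : points h) : 'I_n :=
  match tag x as o return 'I_(tag (part h o)) -> 'I_n with
  | Some j => c j | None => k
  end (tagged x).
have c_ker' j u : c j u \notin kernel_pos p.
  have [_ _ defC] := cP j; have : c j u \in cell_entries p k j by rewrite defC imset_f.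
  by rewrite in_set => /andP[].
have c_cell j u w :
    ((k w < c j u) = (w < cell_col j)) * ((p (k w) < p (c j u)) = (rho w < cell_row j)).
  have [_ _ defC] := cP j; have : c j u \in cell_entries p k j by rewrite defC imset_f.
  by rewrite in_set => /andP[_ /forallP/(_ w)/andP[/eqP-> /eqP->]].
have lower_left (j : 'I_(feasible_count rho)) (w : 'I_s) : w < cell_col j -> cell_row j <= rho w.
  by move=> lt_w; have := feasible_lower_left rho_conn (cell_feasible j) lt_w.
have antitone j j' := feasible_antitone rho_conn (@cell_feasible _ rho j) (@cell_feasible _ rho j').
have e_pos x y : (e x < e y) = (pos_key x < pos_key y).
  apply: (@mono_of_homo_ltn _ _ (fun x => e x : nat) (@pos_key_inj _ _ _ h)) => {x y}.
  elim/pointsP=> [i | j u]; elim/pointsP=> [i' | j' u'] //=;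
    rewrite /e /= ?pos_kk ?pos_kc ?pos_ck.
  - by rewrite k_pos.
  - by rewrite c_cell.
  - by rewrite neq_kernel // c_cell -leqNgt.
  have [eq_j | neq_j] := eqVneq j j'.
    by subst j'; rewrite pos_cc; have [-> _ _] := cP j.
  rewrite pos_cc' // => /orP[lt_c | /andP[/eqP eq_c lt_r]].
    have lt_s : cell_col j < s by rewrite (leq_trans lt_c) // -ltnS.
    have k1 : k (Ordinal lt_s) < c j' u' by rewrite c_cell.
    by apply: ltn_trans k1; rewrite neq_kernel // c_cell ltnn.
  (* In a common column, [w] is the least kernel entry above the lower cell. It lies to the right,
     so it would be the 2 of a mixed occurrence if the lower cell's entry came first. *)
  pose w := (rho^-1)%g (cell_row j').
  have rho_w : rho w = cell_row j' by rewrite permKV.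
  case: (ltngtP (c j u) (c j' u')) => // [lt_u | /val_inj eq_u]; last first.
    have := (c_cell j u w).2; rewrite eq_u c_cell rho_w ltnn.
    by rewrite lt_r.
  have le_w : cell_col j <= w.
    by rewrite leqNgt; apply/negP => /lower_left; rewrite rho_w leqNgt lt_r.
  have : (c j' u', c j u, k w) \in perm_occ p.
    rewrite perm_occE lt_u !neq_kernel // !c_cell rho_w ltnn lt_r -leqNgt.
    by rewrite le_w.
  by move/no_mixed_occ; rewrite k_kernel (negPf (c_ker' _ _)) andbF.
have e_val x y : (p (e x) < p (e y)) = (val_key x < val_key y).
  apply: (@mono_of_homo_ltn _ _ (fun x => p (e x) : nat) (@val_key_inj _ _ _ h)) => {x y}.
  elim/pointsP=> [i | j u]; elim/pointsP=> [i' | j' u'] //=;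
    rewrite /e /= ?val_kk ?val_kc ?val_ck.
  - by rewrite k_val.
  - by rewrite c_cell.
  - by rewrite neq_kernel // c_cell -leqNgt.
  have [eq_j | neq_j] := eqVneq j j'.
    by subst j'; rewrite val_cc; have [_ -> _] := cP j.
  rewrite val_cc' // => /orP[lt_r | /andP[/eqP eq_r lt_c]].
    pose w := (rho^-1)%g (cell_row j).
    have rho_w : rho w = cell_row j by rewrite permKV.
    have k1 : p (k w) < p (c j' u') by rewrite c_cell rho_w.
    by apply: ltn_trans k1; rewrite neq_kernel // c_cell rho_w ltnn.
  (* In a common row, the kernel entry at position [cell_col j'] separates the cells and lies above
     both; it would be the 3 of a mixed occurrence. *)
  have lt_s : cell_col j' < s by rewrite (leq_trans lt_c) // -ltnS.
  pose w := Ordinal lt_s.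
  case: (ltngtP (p (c j u)) (p (c j' u'))) => // [lt_u | /val_inj/perm_inj eq_u]; last first.
    by have := (c_cell j u w).1; rewrite eq_u c_cell /= ltnn lt_c.
  have le_w : cell_row j <= rho w by apply: lower_left.
  have : (c j' u', k w, c j u) \in perm_occ p.
    by rewrite perm_occE lt_u !neq_kernel // !c_cell /= lt_c ltnn -leqNgt le_w.
  by move/no_mixed_occ; rewrite k_kernel (negPf (c_ker' _ _)) andbF.
exists h, e; split=> //.
have e_inj : injective e.
  by move=> x y eq_e; apply: (inj_of_mono_ltn (@pos_key_inj _ _ _ h) e_pos); rewrite eq_e.
have [e' e'K] : exists e', forall i, e (e' i) = i.
  apply: (@fin_all_exists _ (fun=> points h) (fun i x => e x = i)) => i.
  have [/kernel_k[u ->] | ker'i] := boolP (i \in kernel_pos p).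
    by exists (kernel_pt h u).
  have [j] := cell_of_entry ker'i; have [_ _ ->] := cP j.
  by case/imsetP => u _ ->; exists (cell_pt u).
by exists e' => // x; apply: e_inj; rewrite e'K.
Qed.

End KernelShapes.

(** * Counting *)

(** Allows the relation [inflates] to serve as a bijection without building a map in either
    direction. *)
Lemma card_bij_rel (T U : finType) (A : {set T}) (B : {set U})
    (R : T -> U -> Prop) :
    (forall a, a \in A -> exists2 b, b \in B & R a b) ->
    (forall b, b \in B -> exists2 a, a \in A & R a b) ->
    (forall a b b', R a b -> R a b' -> b = b') ->
    (forall a a' b, R a b -> R a' b -> a = a') ->
  #|A| = #|B|.
Proof.
move=> RA RB R_fun R_inj.
have [A0 | [a0 /RA[b0 _ _]]] := set_0Vmem A.
  suff -> : B = set0 by rewrite A0 !cards0.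
  by apply/setP => b; rewrite inE; apply/negP => /RB[a]; rewrite A0 inE.
have [f fP] : exists f : T -> U, forall a, a \in A -> f a \in B /\ R a (f a).
  apply: (@fin_all_exists _ (fun=> U) (fun a b => a \in A -> b \in B /\ R a b)) => a.
  case: (boolP (a \in A)) => [/RA[b Bb Rab] | nAa]; last by exists b0.
  by exists b.
rewrite -(@card_in_imset _ _ f A).
  apply: eq_card => b; apply/imsetP/idP => [[a /fP[Bfa _] ->] // | /RB[a Aa Rab]].
  by exists a => //; apply: R_fun Rab _; case: (fP a Aa).
move=> a a' /fP[_ Ra] /fP[_ Ra'] eq_f; apply: R_inj Ra _.
by rewrite eq_f.
Qed.

Section CountInflations.
Variables (s : nat) (rho : 'S_s).
Hypotheses (s_gt0 : 0 < s) (rho_conn : kernel_pos rho = [set: 'I_s]).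
Notation F := (feasible_count rho).

(** The embedding of the kernel is unique, so both families have the same [cell_entries], whose
    patterns are unique. *)
Lemma inflates_unique_cells N n (p : 'S_n)
    (h h' : {ffun 'I_F -> {k : 'I_N.+1 & 'S_k}}) e e' :
  inflates (h := h) p e -> inflates (h := h') p e' -> h = h'.
Proof.
move=> infl infl'; apply/ffunP => j.
have k_eq := embeds_unique_emb (embeds_kernel s_gt0 rho_conn infl)
                               (embeds_kernel s_gt0 rho_conn infl').
have := embeds_cell s_gt0 rho_conn infl' j.
have -> : cell_entries p (fun i => e' (kernel_pt h' i)) j
        = cell_entries p (fun i => e (kernel_pt h i)) j.
  by apply/setP => i; rewrite !in_set; congr andb; apply: eq_forallb => w;
     rewrite k_eq.
exact: embeds_unique (embeds_cell s_gt0 rho_conn infl j).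
Qed.

Lemma inflates_unique_perm N n (p p' : 'S_n)
    (h : {ffun 'I_F -> {k : 'I_N.+1 & 'S_k}}) e e' :
  inflates (h := h) p e -> inflates (h := h) p' e' -> p = p'.
Proof.
move=> [e_bij e_pos e_val] [_ e'_pos e'_val].
have ee' : e =1 e'.
  apply: rank_unique (bij_inj e_bij) _ _.
    by rewrite (bij_eq_card e_bij) card_ord.
  by move=> x y; rewrite e_pos e'_pos.
case: e_bij => f _ fK; apply: std_unique => u v.
by rewrite -(fK u) -(fK v) e_val !ee' e'_val.
Qed.

(** Lengths and occurrences add under [inflates]. Cell contents have length at most [n], so taking
    [N = n] loses no family. *)
Lemma card_kernel_shape r n :
  #|[set p : 'S_n | (#|perm_occ p| == r) && is_kernel_shape p rho]|
  = #|[set h : {ffun 'I_F -> {k : 'I_n.+1 & 'S_k}} |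
        (s + \sum_j tag (h j) == n) &&
        (\sum_j #|perm_occ (tagged (h j))| + capacity rho == r)]|.
Proof.
apply: (card_bij_rel (R := fun p h => exists e, inflates (h := h) p e)).
- move=> p; rewrite in_set => /andP[/eqP occ_p /embedsP[k emb]].
  have n_gt0 : 0 < n by apply: leq_ltn_trans (ltn_ord (k (Ordinal s_gt0))).
  have [h [e infl]] := kernel_shape_inflates emb n_gt0.
  exists h; last by exists e.
  rewrite in_set -card_points addnC -(card_perm_occ_inflation rho_conn infl).
  by case: infl => e_bij _ _; rewrite (bij_eq_card e_bij) card_ord occ_p !eqxx.
- move=> h; rewrite in_set -card_points => /andP[/eqP card_h /eqP occ_h].
  have [p [e infl]] := inflation_exists card_h.
  exists p; last by exists e.
  rewrite in_set (card_perm_occ_inflation rho_conn infl) addnC occ_h eqxx /=.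
  by apply/embedsP; exists (fun i => e (kernel_pt h i)); apply: embeds_kernel.
- by move=> p h h' [e infl] [e' infl']; apply: inflates_unique_cells infl infl'.
by move=> p p' h [e infl] [e' infl']; apply: inflates_unique_perm infl infl'.
Qed.

(* The padding goes to the cell below and to the right of all kernel entries,
   which is always feasible. *)
Lemma kernel_shape_pad t : s <= t -> exists p : 'S_t, is_kernel_shape p rho.
Proof.
move=> le_st.
have feas : ~~ infeasible rho (Ordinal s_gt0, ord_max).
  apply/negP => /infeasibleP[i [i']]; rewrite /cell_hit /=.
  by rewrite !ltn0 leqNgt ltn_ord leqNgt ltn_ord !andbF.
have [j _] := cell_exists feas.
have lt_ts : t - s < t.+1 by rewrite ltnS leq_subr.
pose h := [ffun i => if i == j then Tagged (fun k : 'I_t.+1 => 'S_k) (1%g : 'S_(Ordinal lt_ts))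
                     else Tagged (fun k : 'I_t.+1 => 'S_k) (1%g : 'S_(@ord0 t))].
have card_h : #|{: points h}| = t.
  rewrite card_points (bigD1 j) //= big1 => [|i neq_ij]; last first.
    by rewrite ffunE (negPf neq_ij).
  by rewrite ffunE eqxx /= addn0 subnKC.
have [p [e infl]] := inflation_exists card_h; exists p.
by apply/embedsP; exists (fun i => e (kernel_pt h i)); apply: embeds_kernel.
Qed.

End CountInflations.

Lemma kernel_shapes_conn t s (rho : 'S_s) (lt_s : s < t.+1) : 0 < t ->
    Tagged (fun s : 'I_t.+1 => 'S_s) (rho : 'S_(Ordinal lt_s)) \in kernel_shapes t ->
  0 < s /\ kernel_pos rho = [set: 'I_s].
Proof.
move=> t_gt0; rewrite inE /= => /existsP[p /embedsP[k emb]].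
by split; [apply: kernel_shape_gt0 emb t_gt0 | apply: kernel_shape_conn emb].
Qed.

(** The length of [p] need not be [t]: its shape is connected, so it can be padded to a permutation
    of length [t] with the same shape. *)
Lemma kernel_shape_unique n (p : 'S_n) t : 0 < n -> #|kernel_pos p| <= t ->
  exists rho0, forall rho : {s : 'I_t.+1 & 'S_s},
    (rho \in kernel_shapes t) && is_kernel_shape p (tagged rho) = (rho == rho0).
Proof.
move=> n_gt0 le_t; have [q [k emb]] := embeds_exists p (kernel_pos p).
have lt_t : #|kernel_pos p| < t.+1 by rewrite ltnS.
pose rho0 := Tagged (fun s : 'I_t.+1 => 'S_s) (q : 'S_(Ordinal lt_t)).
have emb0 : embeds p (kernel_pos p) (tagged rho0) k by [].
exists rho0 => rho.
apply/andP/eqP => [[_ /embedsP[k' emb']] | ->]; first exact: embeds_unique emb' emb0.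
split; last by apply/embedsP; exists k.
rewrite inE; apply/existsP.
have [p' p'P] := kernel_shape_pad (kernel_shape_gt0 emb n_gt0) (kernel_shape_conn emb) le_t.
by exists p'.
Qed.

Lemma psi_kernel_shapes r n : 0 < r ->
  psi r n = \sum_(rho in kernel_shapes (2 * r + 1))
    #|[set p : 'S_n | (#|perm_occ p| == r) && is_kernel_shape p (tagged rho)]|.
Proof.
move=> r_gt0; rewrite /psi cardsE -sum1_card.
under [RHS]eq_bigr => rho _ do rewrite cardsE -sum1_card.
rewrite (exchange_big_dep (fun p : 'S_n => #|perm_occ p| == r)) /=; last first.
  by move=> rho p _ /andP[].
apply: eq_bigr => p /eqP occ_p.
(* Here [0 < r] matters: an occurrence exists, so [p] is not the empty permutation. *)
have n_gt0 : 0 < n.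
  have /card_gt0P[[[a c] b] _] : 0 < #|perm_occ p| by rewrite occ_p.
  exact: leq_ltn_trans (ltn_ord a).
have le_ker : #|kernel_pos p| <= 2 * r + 1 by rewrite -occ_p card_kernel_pos.
have [rho0 rho0P] := kernel_shape_unique n_gt0 le_ker.
rewrite (big_pred1 rho0) // => rho.
by rewrite [RHS]/= -rho0P [p \in _]unfold_in occ_p eqxx.
Qed.

(** * Coefficients of the power series *)

Section Series.
Local Open Scope ring_scope.

Lemma fcoef_sum (R : comNzRingType) (I : Type) (r : seq I) (P : pred I)
    (f : I -> fps R) n :
  fcoef (\sum_(i <- r | P i) f i) n = \sum_(i <- r | P i) fcoef (f i) n.
Proof. by apply: (big_morph (fun g => fcoef g n)). Qed.

Lemma fcoefXn (R : comNzRingType) k n : fcoef (fpsX R ^+ k) n = (n == k)%:R.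
Proof.
elim: k n => [|k IHk] [|n] //.
  by rewrite exprS /= big_ord_recl big_ord0 /= mul0r addr0.
rewrite exprS /= big_ord_recl /= mul0r add0r big_ord_recl /= mul1r subSS subn0.
by rewrite IHk big1 ?addr0 // => i _; rewrite mul0r.
Qed.

(** Congruence modulo the power [n + 1] of the variable. *)
Definition fps_agree (R : comNzRingType) n (f g : fps R) :=
  forall k, (k <= n)%N -> fcoef f k = fcoef g k.

Lemma fps_agreeM (R : comNzRingType) n (f f' g g' : fps R) :
  fps_agree n f f' -> fps_agree n g g' -> fps_agree n (f * g) (f' * g').
Proof.
move=> ff' gg' k le_kn /=; apply: eq_bigr => i _.
rewrite ff' ?gg' ?(leq_trans (leq_subr _ _)) //.
by rewrite (leq_trans _ le_kn) // -ltnS.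
Qed.

Lemma fps_agree_prod (R : comNzRingType) n (I : finType) (f g : I -> fps R) :
  (forall i, fps_agree n (f i) (g i)) -> fps_agree n (\prod_i f i) (\prod_i g i).
Proof.
move=> fg; apply: (big_ind2 (fps_agree n)) => // f1 f2 g1 g2.
exact: fps_agreeM.
Qed.

(** Up to degree [n], [Psi r] is a finite sum of monomials indexed by permutations, so products of
    such series can be expanded. *)
Lemma Psi_agree r n :
  fps_agree n (Psi r)
    (\sum_(x : {k : 'I_n.+1 & 'S_k} | #|perm_occ (tagged x)| == r)
        fpsX int ^+ tag x).
Proof.
move=> k le_kn; rewrite fcoef_sum; under eq_bigr => x _ do rewrite fcoefXn.
rewrite -(sig_big_dep xpredT (fun (m : 'I_n.+1) (q : 'S_m) => #|perm_occ q| == r)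
            (fun m _ => (k == m)%:R)) /=.
rewrite (bigD1 (Ordinal (le_kn : k < n.+1)%N)) //= [X in _ + X]big1 ?addr0.
  by rewrite /psi cardsE -sum1_card natr_sum eqxx; apply: eq_bigl.
move=> m neq_m; apply: big1 => q _.
by have -> : (k == m) = false by apply: contraNF neq_m => /eqP eq_k; apply/eqP/val_inj.
Qed.

(** Distributivity turns the product of truncated series into a sum over families [h]; exchanging
    the sums leaves one composition for each admissible [h]. *)
Lemma fcoef_compositions F r c s n :
  fcoef (fpsX int ^+ s * \sum_(g in weak_compositions F r c) \prod_(j < F) Psi (g j)) n
  = #|[set h : {ffun 'I_F -> {k : 'I_n.+1 & 'S_k}} |
        (s + \sum_j tag (h j) == n)%N &&
        (\sum_j #|perm_occ (tagged (h j))| + c == r)%N]|%:R.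
Proof.
rewrite mulr_sumr fcoef_sum.
transitivity (\sum_(g in weak_compositions F r c)
   \sum_(h : {ffun 'I_F -> {k : 'I_n.+1 & 'S_k}} |
           [forall j, #|perm_occ (tagged (h j))| == g j])
     (n == s + \sum_j tag (h j))%N%:R : int).
  apply: eq_bigr => g _.
  have := fps_agreeM (fun _ _ => erefl _) (fps_agree_prod (fun j => @Psi_agree (g j) n)).
  move=> /(_ (fpsX int ^+ s) n (leqnn n)) ->.
  rewrite bigA_distr_big_dep mulr_sumr fcoef_sum.
  apply: eq_big => [h | h _].
    by apply/familyP/forallP => hg j; have := hg j; rewrite unfold_in.
  by rewrite prodrXr -exprD fcoefXn.
rewrite (exchange_big_dep xpredT) //= -sum1_card natr_sum.
rewrite [RHS]big_mkcond; apply: eq_bigr => h _; rewrite inE eq_sym.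
case: eqP => [_ | neq_n] /=; last first.
  by rewrite big1 //; case: eqP neq_n.
have [occ_h | neq_r] := eqVneq (\sum_j #|perm_occ (tagged (h j))| + c)%N r; last first.
  rewrite big1 // => g; rewrite inE => /andP[/eqP occ_g /forallP gP].
  case/eqP: neq_r; rewrite -occ_g; congr addn; apply: eq_bigr => j _.
  exact/eqP.
have le_r j : (#|perm_occ (tagged (h j))| < r.+1)%N.
  by rewrite ltnS -occ_h (bigD1 j) //= -addnA leq_addr.
(* The only composition compatible with [h] lists the occurrence numbers of its members. *)
pose g0 : {ffun 'I_F -> 'I_r.+1} := [ffun j => Ordinal (le_r j)].
rewrite (big_pred1 g0) // => g; rewrite inE; apply/andP/eqP => [[_ /forallP gP] | ->].
  by apply/ffunP => j; apply: val_inj; rewrite ffunE /=; apply/esym/eqP.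
split; last by apply/forallP => j; rewrite ffunE.
by apply/eqP; rewrite -[RHS]occ_h; congr addn; apply: eq_bigr => j _; rewrite ffunE.
Qed.

End Series.

Local Open Scope ring_scope.

Theorem theorem4 (r : nat) (hr : (1 <= r)%N) :
  Psi r =
  \sum_(rho in kernel_shapes (2 * r + 1)%N)
    fpsX int ^+ (tag rho) *
    \sum_(g in weak_compositions (feasible_count (tagged rho)) r
                 (capacity (tagged rho)))
      \prod_(j < feasible_count (tagged rho)) Psi (g j).
Proof.
(* Coefficients are compared shape by shape: both sides count the families of cell contents. *)
apply: fpsP => n; rewrite fcoef_sum [LHS]/= psi_kernel_shapes // natr_sum.
apply: eq_bigr => -[[s lt_s] rho].
move=> /kernel_shapes_conn[|s_gt0 rho_conn]; first by rewrite addn1.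
by rewrite fcoef_compositions /= card_kernel_shape.
Qed.
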